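(* Let $(A,\cdot,\circ)$ be an anti-pre-Lie Poisson algebra and $(\mu,l_\circ,r_\circ,V)$ a representation of $(A,\cdot,\circ)$. Let $\hat A=A\ltimes_{-\mu^*,\,r_\circ^*-l_\circ^*,\,r_\circ^*}V^*$ be the semi-direct product anti-pre-Lie Poisson algebra. Let $T:V\to A$ be a linear map, identified with an element of $\hat A\otimes\hat A$ (through $\mathrm{Hom}(V,A)\cong A\otimes V^*\subseteq\hat A\otimes\hat A$). Then $r=T-\tau(T)$ is a skew-symmetric solution of the APLP-YBE in $\hat A$ if and only if $T$ is an $\mathcal O$-operator of $(A,\cdot,\circ)$ associated to $(\mu,l_\circ,r_\circ,V)$.
   Context: All vector spaces and algebras are finite-dimensional over an algebraically closed field $\mathbb K$ of characteristic zero. Anti-pre-Lie algebra $(A,\circ)$: with $[x,y]=x\circ y-y\circ x$, $x\circ(y\circ z)-y\circ(x\circ z)=[y,x]\circ z$ and $[x,y]\circ z+[y,z]\circ x+[z,x]\circ y=0$. Anti-pre-Lie Poisson algebra $(A,\cdot,\circ)$: $(A,\cdot)$ commutative associative, $(A,\circ)$ anti-pre-Lie, $2(x\circ y)\cdot z-2(y\circ x)\cdot z=y\cdot(x\circ z)-x\cdot(y\circ z)$ and $2x\circ(y\cdot z)=(z\cdot x)\circ y+z\cdot(x\circ y)$. Representation $(\mu,l,r,V)$ of $(A,\cdot,\circ)$: linear maps $\mu,l,r:A\to\mathrm{End}(V)$ such that for all $x,y\in A$: $\mu(x\cdot y)=\mu(x)\mu(y)$; $l(y\circ x)-l(x\circ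 y)=l(x)l(y)-l(y)l(x)$; $r(x\circ y)=l(x)r(y)+r(y)l(x)-r(y)r(x)$; $l(y\circ x)-l(x\circ y)=r(x)l(y)-r(y)l(x)-r(x)r(y)+r(y)r(x)$; $2\mu(y)l(x)-2\mu(y)r(x)=\mu(x\circ y)-\mu(x)r(y)$; $2\mu(x\circ y)-2\mu(y\circ x)=\mu(y)l(x)-\mu(x)l(y)$; $2r(x\cdot y)=r(y)\mu(x)+\mu(x)r(y)$; $2l(x)\mu(y)=l(x\cdot y)+\mu(y)l(x)$; $2l(x)\mu(y)=r(y)\mu(x)+\mu(x\circ y)$. The semi-direct product $A\ltimes_{\mu,l,r}V$ is $A\oplus V$ with $(x+u)\cdot(y+v)=x\cdot y+\mu(x)v+\mu(y)u$ and $(x+u)\circ(y+v)=x\circ y+l(x)v+r(y)u$; it is an anti-pre-Lie Poisson algebra. For linear $\rho:A\to\mathrm{End}(V)$, $\langle\rho^*(x)u^*,v\rangle=-\langle u^*,\rho(x)v\rangle$. If $(\mu,l,r,V)$ is a representation, so is $(-\mu^*,r^*-l^*,r^*,V^* )$. With $\{v_k\}$ a basis of $V$ and $\{v_k^*\}$ its dual basis, $T$ is identified with $\sum_kT(v_k)\otimes v_k^*$; $\tau(x\otimes y)=y\otimes x$; $r$ is skew-symmetric if $\tau(r)=-r$. APLP-YBE: $r=\sum_ia_i\otimes b_i$ is a solution if both $\sum_{i,j}\big(a_i\cdot a_j\otimes b_i\otimes b_j-a_j\otimes a_i\cdot b_j\otimes b_i+a_i\otimes a_j\otimes b_i\cdot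 b_j\big)=0$ and $\sum_{i,j}\big(a_i\circ a_j\otimes b_i\otimes b_j+a_i\otimes b_i\circ a_j\otimes b_j-a_i\otimes a_j\otimes[b_i,b_j]\big)=0$. $\mathcal O$-operator of $(A,\cdot,\circ)$ associated to $(\mu,l_\circ,r_\circ,V)$: a linear map $T:V\to A$ with $T(u)\cdot T(v)=T\big(\mu(T(u))v+\mu(T(v))u\big)$ and $T(u)\circ T(v)=T\big(l_\circ(T(u))v+r_\circ(T(v))u\big)$ for all $u,v\in V$. *)

(* Defs.v *)
From HB Require Import structures.
From mathcomp Require Import all_boot all_order all_algebra.

Set Implicit Arguments.
Unset Strict Implicit.
Unset Printing Implicit Defensive.

Import GRing.Theory VectorInternalTheory.
Local Open Scope ring_scope.

(* The tensor product of two finite-dimensional spaces, modelled on the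
   coordinate bases: u ⊗ w is the rank-one matrix u^T w.  [tens_universal]
   below is the usual universal property. *)
Definition tens (K : fieldType) (U W : vectType K) : vectType K :=
  'M[K]_(dim U, dim W).

Definition tmul (K : fieldType) (U W : vectType K) (u : U) (w : W) :
  tens U W := (v2r u)^T *m v2r w.

Notation "u ⊗ w" := (tmul u w) (at level 40, left associativity) : ring_scope.

Definition flip (K : fieldType) (U W : vectType K) (t : tens U W) :
  tens W U := t^T.

Section Tensor.
Variables (K : fieldType) (U W : vectType K).

Lemma tmul_is_bilinear : bilinear_for *:%R *:%R (@tmul K U W).
Proof.
split=> [w a u v|u a w v] /=; rewrite /tmul linearP.
  by rewrite linearP mulmxDl scalemxAl.
by rewrite mulmxDr scalemxAr.
Qed.

HB.instance Definition _ :=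
  bilinear_isBilinear.Build K U W (tens U W) *:%R *:%R (@tmul K U W)
    tmul_is_bilinear.

Lemma flip_is_linear : linear (@flip K U W).
Proof. by move=> a s t; rewrite /flip linearP. Qed.

HB.instance Definition _ :=
  GRing.isLinear.Build K (tens U W) (tens W U) _ (@flip K U W) flip_is_linear.

Lemma flip_tmul (u : U) (w : W) : flip (u ⊗ w) = w ⊗ u.
Proof. by rewrite /flip /tmul trmx_mul trmxK. Qed.

Lemma tens_decomp (t : tens U W) :
  exists (n : nat) (a : 'I_n -> U) (b : 'I_n -> W), t = \sum_i a i ⊗ b i.
Proof.
exists (dim U), (fun i => r2v (delta_mx 0 i)), (fun i => r2v (row i t)).
rewrite [t in LHS](matrix_sum_delta (t : 'M_(_, _))); apply: eq_bigr => i _.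
rewrite /tmul !r2vK trmx_delta; apply/matrixP=> p q.
rewrite summxE [RHS]mxE big_ord1 !mxE eqxx andbT.
rewrite (bigD1 q) //= big1 ?addr0 => [|j /negPf nj].
  rewrite !mxE eqxx andbT; case: (p == i); first by rewrite mulr1 mul1r.
  by rewrite mulr0 mul0r.
by rewrite !mxE [q == j]eq_sym nj andbF mulr0.
Qed.

Lemma tens_universal (X : vectType K) (f : {bilinear U -> W -> X}) :
  exists! F : 'Hom(tens U W, X), forall u w, F (u ⊗ w) = f u w.
Proof.
pose eU i : U := r2v (delta_mx 0 i); pose eW j : W := r2v (delta_mx 0 j).
pose g (t : tens U W) := \sum_i \sum_j (t : 'M_(_, _)) i j *: f (eU i) (eW j).
have glin : linear g.
  move=> a s t; rewrite /g scaler_sumr -big_split; apply: eq_bigr => i _ /=.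
  rewrite scaler_sumr -big_split; apply: eq_bigr => j _ /=.
  by rewrite !mxE scalerDl scalerA.
pose G := GRing.isLinear.Build K (tens U W) X _ g glin.
pose gl : {linear tens U W -> X} := HB.pack g G.
have dec (Y : vectType K) (y : Y) :
  y = \sum_i (v2r y) 0 i *: (r2v (delta_mx 0 i) : Y).
  by rewrite -[LHS]v2rK [v2r y in LHS]row_sum_delta linear_sum;
     apply: eq_bigr => i _; rewrite linearZ.
have glE u w : linfun gl (u ⊗ w) = f u w.
  rewrite lfunE /= /g [u in RHS]dec linear_sumlz; apply: eq_bigr => i _.
  rewrite [w in RHS]dec linear_sumr; apply: eq_bigr => j _.
  by rewrite linearZl_LR linearZr_LR /= scalerA /tmul mxE big_ord1 !mxE mulrC.
exists (linfun gl); split=> [//|F HF].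
apply/lfunP=> t; have [n [a [b ->]]] := tens_decomp t.
by rewrite !linear_sum; apply: eq_bigr => i _ /=; rewrite HF glE.
Qed.

End Tensor.

Section Algebras.
Variables (K : fieldType) (A : vectType K).
Implicit Types dot circ : {bilinear A -> A -> A}.

Definition commutator circ (x y : A) : A := circ x y - circ y x.

Definition anti_pre_lie circ : Prop :=
  (forall x y z, circ x (circ y z) - circ y (circ x z)
                 = circ (commutator circ y x) z) /\
  (forall x y z, circ (commutator circ x y) z + circ (commutator circ y z) x
                 + circ (commutator circ z x) y = 0).

Record anti_pre_lie_poisson dot circ : Prop := AntiPreLiePoisson {
  aplp_comm : commutative dot;
  aplp_assoc : associative dot;
  aplp_apl : anti_pre_lie circ;
  aplp_compat1 : forall x y z,
    dot (circ x y) z *+ 2 - dot (circ y x) z *+ 2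
    = dot y (circ x z) - dot x (circ y z);
  aplp_compat2 : forall x y z,
    circ x (dot y z) *+ 2 = circ (dot z x) y + dot z (circ x y)
}.

Record representation dot circ (V : vectType K) (mu l r : 'Hom(A, 'End(V))) :
  Prop := Representation {
  rep_mul : forall x y, mu (dot x y) = (mu x \o mu y)%VF;
  rep_ll : forall x y,
    l (circ y x) - l (circ x y) = (l x \o l y)%VF - (l y \o l x)%VF;
  rep_r : forall x y,
    r (circ x y) = (l x \o r y)%VF + (r y \o l x)%VF - (r y \o r x)%VF;
  rep_lr : forall x y,
    l (circ y x) - l (circ x y)
    = (r x \o l y)%VF - (r y \o l x)%VF - (r x \o r y)%VF + (r y \o r x)%VF;
  rep_mul_lr : forall x y,
    (mu y \o l x)%VF *+ 2 - (mu y \o r x)%VF *+ 2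
    = mu (circ x y) - (mu x \o r y)%VF;
  rep_mul_comm : forall x y,
    mu (circ x y) *+ 2 - mu (circ y x) *+ 2
    = (mu y \o l x)%VF - (mu x \o l y)%VF;
  rep_r_mul : forall x y,
    r (dot x y) *+ 2 = (r y \o mu x)%VF + (mu x \o r y)%VF;
  rep_l_mul1 : forall x y,
    (l x \o mu y)%VF *+ 2 = l (dot x y) + (mu y \o l x)%VF;
  rep_l_mul2 : forall x y,
    (l x \o mu y)%VF *+ 2 = (r y \o mu x)%VF + mu (circ x y)
}.

Definition O_operator dot circ (V : vectType K) (mu l r : 'Hom(A, 'End(V)))
    (T : 'Hom(V, A)) : Prop :=
  (forall u v, dot (T u) (T v) = T (mu (T u) v + mu (T v) u)) /\
  (forall u v, circ (T u) (T v) = T (l (T u) v + r (T v) u)).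

(* The left-hand sides depend only on t, not on the chosen expression of t as
   a sum of pure tensors; one exists by [tens_decomp]. *)
Definition APLP_YBE dot circ (t : tens A A) : Prop :=
  forall (n : nat) (a b : 'I_n -> A), t = \sum_i a i ⊗ b i ->
    (\sum_i \sum_j (dot (a i) (a j) ⊗ b i ⊗ b j
                    - a j ⊗ dot (a i) (b j) ⊗ b i
                    + a i ⊗ a j ⊗ dot (b i) (b j)) = 0) /\
    (\sum_i \sum_j (circ (a i) (a j) ⊗ b i ⊗ b j
                    + a i ⊗ circ (b i) (a j) ⊗ b j
                    - a i ⊗ a j ⊗ commutator circ (b i) (b j)) = 0).

Definition skew_symmetric (t : tens A A) : Prop := flip t = - t.

End Algebras.

Section SemiDirect.
Variables (K : fieldType) (A V : vectType K).

Definition semidirect : vectType K := (A * V)%type.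

Definition semidirect_dot (dot : {bilinear A -> A -> A})
    (mu : 'Hom(A, 'End(V))) (p q : semidirect) : semidirect :=
  (dot p.1 q.1, mu p.1 q.2 + mu q.1 p.2).

Definition semidirect_circ (circ : {bilinear A -> A -> A})
    (l r : 'Hom(A, 'End(V))) (p q : semidirect) : semidirect :=
  (circ p.1 q.1, l p.1 q.2 + r q.1 p.2).

Lemma semidirect_circ_bilinear (circ : {bilinear A -> A -> A})
  (l r : 'Hom(A, 'End(V))) :
  bilinear_for *:%R *:%R (semidirect_circ circ l r).
Proof.
by split=> [[x u] c [y v] [z w]|[x u] c [y v] [z w]];
  congr pair; rewrite /= ?linearPl ?linearPr // !linearP /= add_lfunE
    scale_lfunE scalerDr addrACA.
Qed.

HB.instance Definition _ circ l r :=
  bilinear_isBilinear.Build K semidirect semidirect semidirect *:%R *:%R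
    (semidirect_circ circ l r) (semidirect_circ_bilinear circ l r).

Lemma semidirect_dot_bilinear (dot : {bilinear A -> A -> A})
  (mu : 'Hom(A, 'End(V))) :
  bilinear_for *:%R *:%R (semidirect_dot dot mu).
Proof. exact: (semidirect_circ_bilinear dot mu mu). Qed.

HB.instance Definition _ dot mu :=
  bilinear_isBilinear.Build K semidirect semidirect semidirect *:%R *:%R
    (semidirect_dot dot mu) (semidirect_dot_bilinear dot mu).

End SemiDirect.

Section Dual.
Variables (K : fieldType) (A V : vectType K).

Definition dual_endo (f : 'End(V)) (phi : 'Hom(V, K^o)) : 'Hom(V, K^o) :=
  - (phi \o f)%VF.

Lemma dual_endo_linear f : linear (dual_endo f).
Proof.
move=> a phi psi; apply/lfunP=> v; rewrite /dual_endo.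
by rewrite !(opp_lfunE, add_lfunE, scale_lfunE, comp_lfunE) opprD scalerN.
Qed.

HB.instance Definition _ f :=
  GRing.isLinear.Build K 'Hom(V, K^o) 'Hom(V, K^o) _ (dual_endo f)
    (dual_endo_linear f).

Definition dual_action_fun (rho : 'Hom(A, 'End(V))) (x : A) :
  'End('Hom(V, K^o)) := linfun (dual_endo (rho x)).

Lemma dual_action_linear rho : linear (dual_action_fun rho).
Proof.
move=> a x y; apply/lfunP=> phi; apply/lfunP=> v.
rewrite add_lfunE scale_lfunE /dual_action_fun !(lfunE (dual_endo _)) /=.
rewrite /dual_endo.
rewrite !(opp_lfunE, add_lfunE, scale_lfunE, comp_lfunE) linearP /=.
by rewrite add_lfunE scale_lfunE linearP opprD scalerN.
Qed.

HB.instance Definition _ rho :=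
  GRing.isLinear.Build K A 'End('Hom(V, K^o)) _ (dual_action_fun rho)
    (dual_action_linear rho).

Definition dual_action (rho : 'Hom(A, 'End(V))) :
  'Hom(A, 'End('Hom(V, K^o))) := linfun (dual_action_fun rho).

Lemma dual_actionE rho x (phi : 'Hom(V, K^o)) v :
  dual_action rho x phi v = - phi (rho x v).
Proof.
rewrite /dual_action lfunE /= /dual_action_fun lfunE /= /dual_endo.
by rewrite opp_lfunE comp_lfunE.
Qed.

End Dual.

Section HomTensor.
Variables (K : fieldType) (A V : vectType K).

Local Notation hat := (semidirect A 'Hom(V, K^o)).

Definition inl_hat (x : A) : hat := (x, 0).
Definition inr_hat (phi : 'Hom(V, K^o)) : hat := (0, phi).

Lemma inl_hat_linear : linear inl_hat.
Proof. by move=> c x y; congr pair; rewrite /= scaler0 addr0. Qed.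

HB.instance Definition _ :=
  GRing.isLinear.Build K A hat _ inl_hat inl_hat_linear.

Lemma inr_hat_linear : linear inr_hat.
Proof. by move=> c x y; congr pair; rewrite /= scaler0 addr0. Qed.

HB.instance Definition _ :=
  GRing.isLinear.Build K 'Hom(V, K^o) hat _ inr_hat inr_hat_linear.

Definition dual_vect n (e : n.-tuple V) (k : 'I_n) : 'Hom(V, K^o) :=
  linfun (coord e k : V -> K^o).

Definition hom_tensor (T : 'Hom(V, A)) : tens hat hat :=
  \sum_(k < \dim {:V})
    inl_hat (T (vbasis {:V})`_k) ⊗ inr_hat (dual_vect (vbasis {:V}) k).

Lemma hom_tensorE (T : 'Hom(V, A)) n (e : n.-tuple V) : basis_of {:V} e ->
  hom_tensor T = \sum_(k < n) inl_hat (T e`_k) ⊗ inr_hat (dual_vect e k).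
Proof.
move=> eB; rewrite /hom_tensor; set b := vbasis _.
have bB : basis_of {:V} b by exact: vbasisP.
have E1 k : inl_hat (T b`_k) =
    \sum_j coord e j b`_k *: inl_hat (T e`_j).
  rewrite [b`_k in LHS](coord_basis eB) ?memvf // !linear_sum; apply: eq_bigr => j _.
  by rewrite !linearZ.
have E2 j : inr_hat (dual_vect e j) =
    \sum_(k < \dim {:V}) coord e j b`_k *: inr_hat (dual_vect b k).
  have -> : dual_vect e j = \sum_(k < \dim {:V}) coord e j b`_k *: dual_vect b k.
    apply/lfunP=> v; rewrite sum_lfunE lfunE /=.
    rewrite [v in LHS](coord_basis bB) ?memvf // linear_sum.
    apply: eq_bigr => k _; rewrite scale_lfunE lfunE /= linearZ /=.
    by rewrite mulrC.
  rewrite linear_sum; apply: eq_bigr => k _.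
  by rewrite !linearZ.
under eq_bigr => k _ do rewrite E1 linear_sumlz.
under [RHS]eq_bigr => j _ do rewrite E2 linear_sumr.
rewrite exchange_big; apply: eq_bigr => j _; apply: eq_bigr => k _.
by rewrite linearZl_LR linearZr_LR.
Qed.

End HomTensor.

(* Main.v *)
(* A skew-symmetric tensor t on an algebra is the same thing as a linear map R
   from functionals to vectors, R h := (id ⊗ h) t, and skew symmetry gives
   (h ⊗ id) t = - R h.  Pairing the two YBE equations with f ⊗ g ⊗ h turns them
   into trilinear identities in R f, R g, R h.  Functionals on A ⊕ V^* are the
   pairs (α, v) in A^* ⊕ V, and for t = T - τ(T) one gets
   R (α, v) = (T v, - α ∘ T).  With D (v, w) and E (v, w) the defects of T in the
   two O-operator equations, the identities at (α, u), (β, v), (γ, w) become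
     α (D (v, w)) + β (D (w, u)) + γ (D (u, v)) = 0  and
     α (E (v, w)) - β (E (u, w)) - γ (E (u, v) - E (v, u)) = 0,
   which hold for all arguments exactly when D = E = 0. *)

Require Import Defs.
From HB Require Import structures.
From mathcomp Require Import all_boot all_order all_algebra.
From mathcomp Require Import ring.

Set Implicit Arguments.
Unset Strict Implicit.
Unset Printing Implicit Defensive.

Import GRing.Theory.
Local Open Scope ring_scope.

(** * Contracting a tensor with a functional on its second factor *)

Section Contraction.
Variables (K : fieldType) (U W : vectType K).
Import VectorInternalTheory.

Lemma functional_eq0 (x : U) :
  (forall f : 'Hom(U, K^o), f x = 0) -> x = 0.
Proof.
move=> fx0; rewrite [x](coord_vbasis (memvf x)) big1 // => i _.
have := fx0 (linfun (coord (vbasis {:U}) i : U -> K^o)).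
by rewrite lfunE /= => ->; rewrite scale0r.
Qed.

(** This is id ⊗ [h] in the matrix model: row [q] of [flip t] is column [q] of [t], the component in
    [U] attached to the [q]-th coordinate vector of [W]. *)
Definition contract_fun (h : 'Hom(W, K^o)) (t : tens U W) : U :=
  \sum_q h (r2v (delta_mx 0 q)) *: r2v (row q (flip t)).

Lemma contract_is_linear h : linear (contract_fun h).
Proof.
move=> a s t; rewrite /contract_fun scaler_sumr -big_split /=.
by apply: eq_bigr => q _; rewrite !linearP.
Qed.

HB.instance Definition _ h :=
  GRing.isLinear.Build K (tens U W) U _ (contract_fun h)
    (contract_is_linear h).

Definition contract h : 'Hom(tens U W, U) := linfun (contract_fun h).

Lemma contract_tmul h (u : U) (w : W) : contract h (u ⊗ w) = h w *: u.
Proof.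
rewrite lfunE /= /contract_fun flip_tmul /tmul.
rewrite -[w in RHS]v2rK [v2r w in RHS]row_sum_delta !linear_sum scaler_suml.
apply: eq_bigr => q _.
have -> : r2v (row q ((v2r w)^T *m v2r u)) = v2r w 0 q *: u.
  apply: (can_inj v2rK); rewrite r2vK linearZ.
  by apply/rowP=> p; rewrite !mxE big_ord1 !mxE.
by rewrite scalerA mulrC !linearZ.
Qed.

Lemma contract_eq0 (t : tens U W) : (forall h, contract h t = 0) -> t = 0.
Proof.
move=> ht0; apply/matrixP=> p q; rewrite [RHS]mxE.
(* The [q]-th coordinate functional of [W]: contracting with it isolates column [q] of the
   matrix. *)
have [h hE] : exists h : 'Hom(W, K^o), forall w, h w = v2r w 0 q.
  have h_lin : linear ((fun w => v2r w 0 q) : W -> K^o).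
    by move=> a x y; rewrite linearP !mxE.
  pose hL := GRing.isLinear.Build K W K^o _ _ h_lin.
  pose h : {linear W -> K^o} := HB.pack (fun w => v2r w 0 q : K^o) hL.
  by exists (linfun h) => w; rewrite lfunE.
have := ht0 h; rewrite /contract lfunE /= /contract_fun (bigD1 q) //= big1.
  rewrite addr0 hE r2vK mxE !eqxx scale1r => /(congr1 v2r).
  by rewrite r2vK linear0 => /rowP/(_ p); rewrite !mxE.
move=> j /negPf jq; rewrite hE r2vK mxE eq_sym jq andbF.
by rewrite scale0r.
Qed.

End Contraction.

Arguments contract {K U W} h.

(** * The YBE of a skew-symmetric tensor as trilinear identities *)

Section ContractedYBE.
Variables (K : fieldType) (A : vectType K).
Implicit Types (d c : {bilinear A -> A -> A}) (t : tens A A).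
Implicit Types f g h : 'Hom(A, K^o).

Definition contracted_YBE d c (R : 'Hom(A, K^o) -> A) : Prop :=
  forall f g h,
    f (d (R g) (R h)) + g (d (R h) (R f)) + h (d (R f) (R g)) = 0 /\
    f (c (R g) (R h)) - g (c (R f) (R h)) - h (commutator c (R f) (R g)) = 0.

(** Functionals separate points, applied to one tensor factor at a time. *)
Lemma contract3_eq0 (s : tens (tens A A) A) :
  s = 0 <-> forall f g h, f (contract g (contract h s)) = 0.
Proof.
split=> [-> f g h|s0]; first by rewrite !linear0.
apply: contract_eq0 => h; apply: contract_eq0 => g; apply: functional_eq0 => f.
exact: s0.
Qed.

Lemma contract3_tmul f g h (x y z : A) :
  f (contract g (contract h (x ⊗ y ⊗ z))) = f x * (g y * h z).
Proof.
rewrite contract_tmul !linearZ /= contract_tmul linearZ /= scalerA mulrC.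
exact: mulrC.
Qed.

(** By skew symmetry [contract k t] expands either in the [a i] ([RE]) or, with a minus sign, in the
    [b i] ([RE']). Hence every product of legs in the equations, of type aa, ab, ba or bb, comes
    from a product of two contractions. *)
Lemma skew_YBE_contracted d c t : skew_symmetric t ->
  APLP_YBE d c t <-> contracted_YBE d c (fun k => contract k t).
Proof.
move=> t_skew.
have RE n (a b : 'I_n -> A) k : t = \sum_i a i ⊗ b i ->
    contract k t = \sum_i k (b i) *: a i.
  move=> ->; rewrite linear_sum.
  by apply: eq_bigr => i _; rewrite /= contract_tmul.
have RE' n (a b : 'I_n -> A) k : t = \sum_i a i ⊗ b i ->
    contract k t = - \sum_i k (a i) *: b i.
  move=> tE; rewrite -[t]opprK -t_skew tE !linearN !linear_sum /=.
  by apply: eq_bigr => i _; rewrite flip_tmul contract_tmul.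
have key n (a b : 'I_n -> A) f g h : t = \sum_i a i ⊗ b i ->
  let R k := contract k t in
  f (contract g (contract h (\sum_i \sum_j (d (a i) (a j) ⊗ b i ⊗ b j
                    - a j ⊗ d (a i) (b j) ⊗ b i
                    + a i ⊗ a j ⊗ d (b i) (b j)))))
  = f (d (R g) (R h)) + g (d (R h) (R f)) + h (d (R f) (R g)) /\
  f (contract g (contract h (\sum_i \sum_j (c (a i) (a j) ⊗ b i ⊗ b j
                    + a i ⊗ c (b i) (a j) ⊗ b j
                    - a i ⊗ a j ⊗ commutator c (b i) (b j)))))
  = f (c (R g) (R h)) - g (c (R f) (R h)) - h (commutator c (R f) (R g)).
  move=> tE R; pose F : 'Hom(_, K^o) := (f \o (contract g \o contract h))%VF.
  have FE s : f (contract g (contract h s)) = F s by rewrite !comp_lfunE.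
  have F_tmul x y z : F (x ⊗ y ⊗ z) = f x * (g y * h z).
    by rewrite -FE contract3_tmul.
  have mE (m : {bilinear A -> A -> A}) (k : 'Hom(A, K^o))
      (x y : 'I_n -> K) (p q : 'I_n -> A) :
    k (m (\sum_i x i *: p i) (\sum_j y j *: q j))
    = \sum_i \sum_j (x i * (y j * k (m (p i) (q j))) : K).
    rewrite linear_sumlz linear_sum /=; apply: eq_bigr => i _.
    rewrite linear_sumr linear_sum /=; apply: eq_bigr => j _.
    by rewrite linearZl_LR linearZr_LR !linearZ.
  (* Four expansions of the same scalar, one for each choice of legs; each [b] inside the product
     costs a sign, so the signs cancel in [Rbb]. *)
  have Raa (m : {bilinear A -> A -> A}) (k u v : 'Hom(A, K^o)) :
      k (m (R u) (R v))
      = \sum_i \sum_j (u (b i) * (v (b j) * k (m (a i) (a j))) : K).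
    by rewrite /R !(RE _ _ _ _ tE) mE.
  have Rab (m : {bilinear A -> A -> A}) (k u v : 'Hom(A, K^o)) :
      k (m (R u) (R v))
      = - \sum_i \sum_j (u (b i) * (v (a j) * k (m (a i) (b j))) : K).
    by rewrite /R (RE _ _ _ u tE) (RE' _ _ _ v tE) linearNr linearN /= mE.
  have Rba (m : {bilinear A -> A -> A}) (k u v : 'Hom(A, K^o)) :
      k (m (R u) (R v))
      = - \sum_i \sum_j (u (a i) * (v (b j) * k (m (b i) (a j))) : K).
    by rewrite /R (RE _ _ _ v tE) (RE' _ _ _ u tE) linearNl linearN /= mE.
  have Rbb (m : {bilinear A -> A -> A}) (k u v : 'Hom(A, K^o)) :
      k (m (R u) (R v))
      = \sum_i \sum_j (u (a i) * (v (a j) * k (m (b i) (b j))) : K).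
    by rewrite /R !(RE' _ _ _ _ tE) linearNr linearNl opprK mE.
  rewrite !FE; split.
    rewrite Raa Rab Rbb linear_sum -sumrN -!big_split; apply: eq_bigr => i _ /=.
    rewrite linear_sum -sumrN -!big_split; apply: eq_bigr => j _ /=.
    by rewrite linearD linearB /= !F_tmul; ring.
  rewrite /commutator linearB /= Raa Rba Rbb Rbb.
  (* The second half of the commutator has the roles of [f] and [g] swapped; exchanging the sums
     aligns its indices with the other terms. *)
  rewrite [X in _ - (_ - X)]exchange_big /=.
  rewrite opprK opprB addrA linear_sum -sumrN -!big_split.
  apply: eq_bigr => i _ /=.
  rewrite linear_sum -sumrN -!big_split; apply: eq_bigr => j _ /=.
  by rewrite linearB linearD /= !F_tmul linearB /=; ring.
split=> [H f g h|H n a b tE].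
  (* The YBE speaks about all expressions of [t], so one has to be supplied here; conversely [key]
     applies to any given expression. *)
  have [n [a [b tE]]] := tens_decomp t.
  have [H1 H2] := H _ _ _ tE; have [E1 E2] := key _ _ _ f g h tE.
  by rewrite -E1 -E2 H1 H2 !linear0.
by split; apply/contract3_eq0 => f g h; have [E1 E2] := key _ _ _ f g h tE;
  have [H1 H2] := H f g h; rewrite ?E1 ?E2.
Qed.

End ContractedYBE.

(** * Functionals on A ⊕ V^* and the map R defined by T - τ(T) *)

Section HatFunctionals.
Variables (K : fieldType) (A V : vectType K).
Local Notation hat := (semidirect A 'Hom(V, K^o)).

Definition hat_form_fun (alpha : 'Hom(A, K^o)) (v : V) (p : hat) : K^o :=
  alpha p.1 + p.2 v.

Lemma hat_form_is_linear alpha v : linear (hat_form_fun alpha v).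
Proof.
move=> a p q; rewrite /hat_form_fun /= linearP add_lfunE scale_lfunE.
by rewrite scalerDr addrACA.
Qed.

HB.instance Definition _ alpha v :=
  GRing.isLinear.Build K hat K^o _ (hat_form_fun alpha v)
    (hat_form_is_linear alpha v).

Definition hat_form alpha v : 'Hom(hat, K^o) := linfun (hat_form_fun alpha v).

Lemma hat_formE alpha v (x : A) (phi : 'Hom(V, K^o)) :
  hat_form alpha v (x, phi) = alpha x + phi v.
Proof. by rewrite lfunE. Qed.

Lemma dual_vect_decomp (phi : 'Hom(V, K^o)) :
  phi = \sum_(k < \dim {:V}) phi (vbasis {:V})`_k *: dual_vect (vbasis {:V}) k.
Proof.
apply/lfunP=> v; rewrite sum_lfunE [v in LHS](coord_vbasis (memvf v)).
rewrite linear_sum; apply: eq_bigr => k _ /=.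
by rewrite scale_lfunE lfunE linearZ; apply: mulrC.
Qed.

(** This is the reflexivity of V: the restriction of [f] to V^* is evaluation at the vector whose
    coordinates are the values of [f] on the dual basis. *)
Lemma hat_formP (f : 'Hom(hat, K^o)) : exists alpha v, f = hat_form alpha v.
Proof.
exists (f \o linfun (@inl_hat K A V))%VF.
exists (\sum_(k < \dim {:V})
  f (inr_hat A (dual_vect (vbasis {:V}) k)) *: (vbasis {:V})`_k).
apply/lfunP=> -[x phi]; rewrite hat_formE comp_lfunE lfunE /= linear_sum.
have -> : (x, phi) = inl_hat V x + inr_hat A phi :> hat.
  by congr pair; rewrite /= ?addr0 ?add0r.
rewrite linearD; congr (_ + _).
rewrite [phi in LHS]dual_vect_decomp !linear_sum.
by apply: eq_bigr => k _; rewrite !linearZ; apply: mulrC.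
Qed.

Variable T : 'Hom(V, A).

(** On the legs in V^* the functional evaluates at [v], which rebuilds [T v] from its coordinates;
    on the legs in A of the flipped tensor it acts by [alpha], giving the dual basis expansion of α
    ∘ T. *)
Lemma contract_hom_tensor (alpha : 'Hom(A, K^o)) (v : V) :
  contract (hat_form alpha v) (hom_tensor T - flip (hom_tensor T))
  = (T v, - (alpha \o T)%VF).
Proof.
have contract1 : contract (hat_form alpha v) (hom_tensor T) = inl_hat V (T v).
  rewrite [v in RHS](coord_vbasis (memvf v)) !linear_sum.
  apply: eq_bigr => k _; rewrite /= contract_tmul hat_formE linear0 add0r.
  by rewrite lfunE !linearZ.
have contract2 : contract (hat_form alpha v) (flip (hom_tensor T))
    = inr_hat A (alpha \o T)%VF.
  rewrite [(alpha \o T)%VF]dual_vect_decomp !linear_sum.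
  apply: eq_bigr => k _; rewrite /= flip_tmul contract_tmul hat_formE.
  by rewrite lfunE addr0 comp_lfunE linearZ.
rewrite linearB /= contract1 contract2.
by congr pair; rewrite /= ?subr0 ?sub0r.
Qed.

End HatFunctionals.

Section EvalLfun.
Variables (K : fieldType) (U1 U2 U3 : vectType K).
Implicit Types f g : 'Hom(U1, 'Hom(U2, U3)).

Lemma opp_lfun2E f x y : (- f) x y = - f x y.
Proof. by rewrite !opp_lfunE. Qed.

Lemma sub_lfun2E f g x y : (f - g) x y = f x y - g x y.
Proof. by rewrite !(add_lfunE, opp_lfunE). Qed.

End EvalLfun.

(** * Products of values of R and the O-operator equations *)

Section HatProducts.
Variables (K : fieldType) (A V : vectType K).
Variables (dot circ : {bilinear A -> A -> A}).
Variables (mu l r : 'Hom(A, 'End(V))) (T : 'Hom(V, A)).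
Implicit Types (rho sigma : 'Hom(A, 'End(V))).
Implicit Types (a b c : 'Hom(A, K^o)) (u v w : V).

Local Notation hat := (semidirect A 'Hom(V, K^o)).

(** The sign in the dual action cancels the sign in the V^*-component of R. *)
Lemma dual_action_opp rho (x : A) b u :
  dual_action rho x (- (b \o T)%VF) u = b (T (rho x u)).
Proof. by rewrite dual_actionE opp_lfunE comp_lfunE opprK. Qed.

Lemma opp_dual_action_opp rho (x : A) b u :
  (- dual_action rho : 'Hom(A, 'End('Hom(V, K^o)))) x
    (- (b \o T)%VF) u = - b (T (rho x u)).
Proof. by rewrite opp_lfun2E opp_lfunE dual_action_opp. Qed.

Lemma sub_dual_action_opp rho sigma (x : A) b u :
  (dual_action rho - dual_action sigma : 'Hom(A, 'End('Hom(V, K^o)))) x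
    (- (b \o T)%VF) u
  = b (T (rho x u)) - b (T (sigma x u)).
Proof. by rewrite sub_lfun2E add_lfunE opp_lfunE !dual_action_opp. Qed.

Lemma hat_form_semidirect (m : {bilinear A -> A -> A})
    (L R : 'Hom(A, 'End('Hom(V, K^o)))) a u (x y : A) (phi psi : 'Hom(V, K^o)) :
  hat_form a u (semidirect_circ m L R (x, phi) (y, psi))
  = a (m x y) + (L x psi u + R y phi u).
Proof. by rewrite hat_formE (add_lfunE (L x psi)). Qed.

Lemma hat_form_dot a b c u v w :
  hat_form a u (semidirect_dot dot (- dual_action mu)
    (T v, - (b \o T)%VF) (T w, - (c \o T)%VF))
  = a (dot (T v) (T w)) + (- c (T (mu (T v) u)) - b (T (mu (T w) u))).
Proof.
(* [semidirect_dot] is convertible to [semidirect_circ] with equal left and right actions. *)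
etransitivity; first exact: hat_form_semidirect.
by congr (_ + (_ + _)); exact: opp_dual_action_opp.
Qed.

Lemma hat_form_circ a b c u v w :
  hat_form a u (semidirect_circ circ (dual_action r - dual_action l)
    (dual_action r) (T v, - (b \o T)%VF) (T w, - (c \o T)%VF))
  = a (circ (T v) (T w))
    + (c (T (r (T v) u)) - c (T (l (T v) u)) + b (T (r (T w) u))).
Proof.
etransitivity; first exact: hat_form_semidirect.
congr (_ + (_ + _)); last exact: dual_action_opp.
exact: sub_dual_action_opp.
Qed.

(** The products on A ⊕ V^* enter only through functionals of products of values of [R], so they are
    abstracted to these two formulas. *)
Lemma contracted_O_operator (R : 'Hom(hat, K^o) -> hat)
    (hat_dot hat_circ : {bilinear hat -> hat -> hat}) :
  (forall a v, R (hat_form a v) = (T v, - (a \o T)%VF)) ->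
  (forall a b c u v w,
    hat_form a u (hat_dot (T v, - (b \o T)%VF) (T w, - (c \o T)%VF))
    = a (dot (T v) (T w)) + (- c (T (mu (T v) u)) - b (T (mu (T w) u)))) ->
  (forall a b c u v w,
    hat_form a u (hat_circ (T v, - (b \o T)%VF) (T w, - (c \o T)%VF))
    = a (circ (T v) (T w))
      + (c (T (r (T v) u)) - c (T (l (T v) u)) + b (T (r (T w) u)))) ->
  contracted_YBE hat_dot hat_circ R <->
  O_operator dot circ mu l r T.
Proof.
move=> RE dotE circE; split=> [H|[Hd Hc] f g h].
  (* At (α, 0), (0, u), (0, v) the identities collapse to α (D (u, v)) = 0 and α (E (u, v)) = 0,
     where α is arbitrary. *)
  have H' a u v := H (hat_form a 0) (hat_form 0 u) (hat_form 0 v).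
  split=> u v; apply/eqP; rewrite -subr_eq0; apply/eqP/functional_eq0 => a.
    have [+ _] := H' a u v.
    rewrite !RE !dotE !zero_lfunE !linear0 linearB !linearD /= => <-.
    by ring.
  have [_] := H' a u v; rewrite /commutator !RE linearB /= !circE.
  by rewrite !zero_lfunE !linear0 linearB !linearD /= => <-; ring.
have [[a [u ->]] [b [v ->]] [c [w ->]]] :=
  And3 (hat_formP f) (hat_formP g) (hat_formP h).
(* Once the products in A are replaced by images under [T], they cancel against the terms of the
   dual actions. *)
rewrite /commutator !RE linearB /= !dotE !circE !Hd !Hc !linearD /=.
by split; ring.
Qed.

End HatProducts.

Theorem theorem3p41 (K : closedFieldType) (K_char0 : [pchar K] =i pred0)
    (A V : vectType K) (dot circ : {bilinear A -> A -> A})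
    (mu l r : 'Hom(A, 'End(V))) (T : 'Hom(V, A)) :
  anti_pre_lie_poisson dot circ ->
  representation dot circ mu l r ->
  let hat_dot := semidirect_dot dot (- dual_action mu) in
  let hat_circ :=
    semidirect_circ circ (dual_action r - dual_action l) (dual_action r) in
  let t := hom_tensor T - flip (hom_tensor T) in
  (skew_symmetric t /\ APLP_YBE hat_dot hat_circ t) <->
  O_operator dot circ mu l r T.
Proof.
move=> _ _ hat_dot hat_circ t.
have t_skew : skew_symmetric t.
  by rewrite /skew_symmetric linearB /= /flip trmxK opprB.
(* The chain of equivalences is composed from its right end: O-operator, trilinear identities, YBE,
   and finally the conjunction with [t_skew]. *)
apply: (iff_trans _ (contracted_O_operator (contract_hom_tensor T)
  (hat_form_dot dot mu T) (hat_form_circ circ l r T))).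
apply: (iff_trans _ (skew_YBE_contracted hat_dot hat_circ t_skew)).
by split=> [[]|].
Qed.
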